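(* Let $E$ be a (real or complex) Banach space which contains a proper subspace $F$ that is isomorphic to $E$ and complemented in $E$. Then $\mathcal{B}(E)$ does not have open multiplication. If moreover $F$ may be chosen to have infinite codimension in $E$, then the Calkin algebra $\mathcal{Q}(E)$ does not have open multiplication either.
   Context: $\mathcal{B}(E)$ is the Banach algebra of all bounded linear operators on $E$ with the operator norm and composition as multiplication, $\mathcal{K}(E)$ is its closed ideal of compact operators, and $\mathcal{Q}(E)=\mathcal{B}(E)/\mathcal{K}(E)$ is the quotient Banach algebra, called the Calkin algebra of $E$. A subspace $F\subseteq E$ is complemented if it is the range of a bounded linear projection on $E$; ''isomorphic'' means linearly homeomorphic. A Banach algebra $A$ has open multiplication if the map $A\times A\to A$, $(a,b)\mapsto ab$, sends open sets to open sets; equivalently, for all $x,y\in A$ and $\varepsilon>0$ there is $\delta>0$ with $B(xy,\delta)\subseteq B(x,\varepsilon)\cdot B(y,\varepsilon)$, where $B(x,r)$ is the open ball and $U\cdot V=\{uv\colon u\in U,v\in V\}$. *)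

(* Defs.v *)
From HB Require Import structures.
From mathcomp Require Import all_boot all_order all_algebra finmap.
From mathcomp Require Import generic_quotient.
From mathcomp Require Import complex.
From mathcomp Require Import all_classical all_reals.
From mathcomp Require Import topology normedtype.

Set Implicit Arguments.
Unset Strict Implicit.
Unset Printing Implicit Defensive.

Import Order.TTheory GRing.Theory Num.Theory.
Import numFieldNormedType.Exports.

Local Open Scope classical_set_scope.
Local Open Scope ring_scope.
Local Open Scope complex_scope.

Variant scalar_kind := RealScalars | ComplexScalars.

Definition scalars (R : realType) (k : scalar_kind) : numFieldType :=
  match k with RealScalars => R | ComplexScalars => R[i] end.

Section RealComplexSuprema.
Variable R : realType.
Implicit Type A : set R[i].

Lemma real_supremums (A : set R) : A !=set0 -> ubound A !=set0 ->
  supremums A !=set0.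
Proof.
move=> [a Aa] [b Ab]; exists (sup A); split.
  by apply: sup_upper_bound; split; [exists a|exists b].
by move=> y /ge_sup; apply; exists a.
Qed.

Lemma complex_supremums A : A !=set0 -> A `<=` [set x | 0 <= x] ->
  ubound A !=set0 -> supremums A !=set0.
Proof.
move=> [a Aa] A0 [b Ab].
have AE x : A x -> x = (complex.Re x)%:C.
  by move=> /A0 /=; case: x => x y; rewrite lecE /= => /andP[/eqP -> _].
have [||s [us ls]] := @real_supremums (@complex.Re R @` A).
- by exists (complex.Re a); exists a.
- exists (complex.Re b) => _ [x Ax <-].
  by have := Ab _ Ax; rewrite lecE => /andP[].
exists s%:C; split.
  by move=> x Ax; rewrite (AE _ Ax) lecR; apply: us; exists x.
move=> y yA; have := yA _ Aa; rewrite (AE _ Aa) lecE /= => /andP[/eqP Imy _].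
rewrite lecE /= Imy eqxx /=; apply: ls => _ [x Ax <-].
by have := yA _ Ax; rewrite lecE => /andP[].
Qed.

Lemma real_archi (r : R) : 0 < r -> exists n : nat, 2^-1 ^+ n < r.
Proof.
move=> r0; exists (Num.truncn r^-1).+1.
rewrite exprVn -[ltRHS]invrK ltf_pV2 ?posrE ?invr_gt0// ?exprn_gt0//.
apply: lt_trans (truncnS_gt _) _.
by rewrite -natrX ltr_nat ltn_expl.
Qed.

Lemma complex_archi (r : R[i]) : 0 < r -> exists n : nat, 2^-1 ^+ n < r.
Proof.
case: r => x y; rewrite ltcE /= => /andP[/eqP -> /real_archi[n nx]].
exists n; have -> : 2^-1 ^+ n = (2^-1 ^+ n : R)%:C.
  by rewrite rmorphXn fmorphV rmorph_nat.
by rewrite ltcR.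
Qed.

End RealComplexSuprema.

Section ScalarSuprema.
Context {R : realType} {k : scalar_kind}.
Local Notation K := (scalars R k).
Implicit Types A : set K.

Lemma scalars_supremums A : A !=set0 -> A `<=` [set x | 0 <= x] ->
  ubound A !=set0 -> supremums A !=set0.
Proof.
case: k A => A; first by move=> A0 _; exact: real_supremums.
exact: complex_supremums.
Qed.

Lemma scalars_infimums A : A !=set0 -> A `<=` [set x | 0 <= x] ->
  infimums A !=set0.
Proof.
move=> [a Aa] A0.
have [|||s [us ls]] := @scalars_supremums (lbound A `&` [set x | 0 <= x]).
- by exists 0; split => //=.
- by move=> x [].
- by exists a => x [] /(_ _ Aa).
exists s; split.
  by move=> x Ax; apply: ls => y [] /(_ _ Ax).
move=> y yA; have [y0|y0] := boolP (0 <= y); first exact: us.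
have sr : 0 <= s by apply: us; split => //=.
have yr : y \is Num.real.
  by rewrite (ler_real (yA _ Aa)) ger0_real//; exact: A0.
by apply: le_trans sr; rewrite real_leNgt ?real0//; apply: contra y0 => /ltW.
Qed.

Lemma scalars_archi (e : K) : 0 < e -> exists n : nat, 2^-1 ^+ n < e.
Proof. by case: k e => e; [exact: real_archi|exact: complex_archi]. Qed.

End ScalarSuprema.

Definition open_multiplication (A : topologicalType) (mul : A -> A -> A) :=
  forall U : set (A * A), open U -> open [set mul x.1 x.2 | x in U].

Section BoundedOperators.
Context {R : realType} {k : scalar_kind}.
Local Notation K := (scalars R k).
Variable E : normedModType K.

Definition bounded_linear : {pred E -> E} :=
  [pred T | `[< linear T /\ exists M : K, forall x, `|T x| <= M * `|x| >]].

Record bounded_op := BoundedOp {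
  bounded_op_fun :> E -> E ;
  bounded_op_subproof : bounded_op_fun \in bounded_linear }.

HB.instance Definition _ := [isSub for bounded_op_fun].
HB.instance Definition _ := [Choice of bounded_op by <:].

Implicit Types T S : bounded_op.

Lemma bounded_op_ext T S : (forall x, T x = S x) -> T = S.
Proof. by move=> TS; apply: val_inj; apply/funext. Qed.

Lemma bounded_op_linear T : linear T.
Proof. by case: T => T /= /asboolP[]. Qed.

HB.instance Definition _ T :=
  GRing.isLinear.Build K E E *:%R (bounded_op_fun T) (bounded_op_linear T).

Lemma bounded_op_bounded T : exists2 M : K, 0 <= M &
  forall x, `|T x| <= M * `|x|.
Proof.
have := bounded_op_subproof T => /asboolP[_ [M TM]]; exists `|M| => // x.
have [-> |x0] := eqVneq x 0; first by rewrite linear0 !normr0 mulr0.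
have M0 : 0 <= M.
  by rewrite -(pmulr_lge0 _ (_ : 0 < `|x|)) ?normr_gt0// (le_trans _ (TM x)).
by rewrite (ger0_norm M0).
Qed.

Lemma bounded_linear_submod_closed : GRing.submod_closed bounded_linear.
Proof.
split=> [|a f g /asboolP[lf [M fM]] /asboolP[lg [N gN]]]; apply/asboolP; split.
- by move=> a x y /=; rewrite scaler0 addr0.
- by exists 0 => x; rewrite normr0 mul0r.
- move=> b x y /=; rewrite !fctE lf lg !scalerDr !scalerA (mulrC a b).
  exact: addrACA.
- exists (`|a| * M + N) => x; rewrite fctE mulrDl (le_trans (ler_normD _ _))//.
  by rewrite lerD// normrZ -mulrA ler_wpM2l.
Qed.

HB.instance Definition _ :=
  GRing.isSubmodClosed.Build K (E -> E) bounded_linear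
    bounded_linear_submod_closed.
HB.instance Definition _ := [SubChoice_isSubLmodule of bounded_op by <:].

Lemma bounded_linear_id : (fun x : E => x) \in bounded_linear.
Proof. by apply/asboolP; split=> //; exists 1 => x; rewrite mul1r. Qed.

Lemma bounded_linear_comp T S : (fun x => T (S x)) \in bounded_linear.
Proof.
apply/asboolP; split=> [a x y|]; first by rewrite !linearP.
have [M M0 TM] := bounded_op_bounded T; have [N _ SN] := bounded_op_bounded S.
exists (M * N) => x; rewrite (le_trans (TM _))// -mulrA ler_wpM2l//.
Qed.

Definition op_id := BoundedOp bounded_linear_id.
Definition op_comp T S := BoundedOp (bounded_linear_comp T S).

Lemma op_compA : associative op_comp.
Proof. by move=> *; exact/val_inj. Qed.
Lemma op_comp1l : left_id op_id op_comp.
Proof. by move=> *; exact/val_inj. Qed.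
Lemma op_comp1r : right_id op_id op_comp.
Proof. by move=> *; exact/val_inj. Qed.
Lemma op_compDl : left_distributive op_comp +%R.
Proof. by move=> T S U; apply: bounded_op_ext. Qed.
Lemma op_compDr : right_distributive op_comp +%R.
Proof. by move=> T S U; apply: bounded_op_ext => x /=; rewrite linearD. Qed.

HB.instance Definition _ := GRing.Zmodule_isPzRing.Build bounded_op
  op_compA op_comp1l op_comp1r op_compDl op_compDr.

Lemma op_addE T S x : (T + S) x = T x + S x. Proof. by []. Qed.
Lemma op_subE T S x : (T - S) x = T x - S x. Proof. by []. Qed.
Lemma op_scaleE a T x : (a *: T) x = a *: T x. Proof. by []. Qed.
Lemma op_mulE T S x : (T * S) x = T (S x). Proof. by []. Qed.
Lemma op_oneE x : (1 : bounded_op) x = x. Proof. by []. Qed.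

(* The order of R[i] only compares numbers with the same imaginary part, so
   this supremum in K of a set of nonnegative reals is the usual one. *)
Definition opnorm T : K :=
  supremum 0 [set `|T x| | x in [set x : E | `|x| <= 1]].

Lemma opnorm_supremums T :
  supremums [set `|T x| | x in [set x : E | `|x| <= 1]] (opnorm T).
Proof.
rewrite /opnorm /supremum; case: ifPn => [/eqP A0|_].
  suff : set0 `|T 0| by [].
  by rewrite -A0; exists 0 => //=; rewrite normr0.
have [M M0 TM] := bounded_op_bounded T.
apply: xgetPex; apply: scalars_supremums.
- by exists `|T 0|; exists 0 => //=; rewrite normr0.
- by move=> _ [x _ <-] /=.
- exists M => _ [x /= x1 <-]; rewrite (le_trans (TM x))//.
  by rewrite -[leRHS]mulr1 ler_wpM2l.
Qed.

Lemma opnorm_le T (M : K) : (forall x, `|x| <= 1 -> `|T x| <= M) ->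
  opnorm T <= M.
Proof.
by move=> TM; apply: (opnorm_supremums T).2 => _ [x /= x1 <-]; exact: TM.
Qed.

Lemma opnorm_ge0 T : 0 <= opnorm T.
Proof.
rewrite -(normr0 E) -(linear0 T); apply: (opnorm_supremums T).1.
by exists 0 => //=; rewrite normr0.
Qed.

Lemma le_opnorm T x : `|T x| <= opnorm T * `|x|.
Proof.
have [-> |x0] := eqVneq x 0; first by rewrite linear0 normr0 mulr0.
rewrite -ler_pdivrMr ?normr_gt0// mulrC.
rewrite -(ger0_norm (_ : 0 <= `|x|^-1)) ?invr_ge0//.
rewrite -normrZ -linearZ; apply: (opnorm_supremums T).1.
exists (`|x|^-1 *: x) => //=.
by rewrite normrZ ger0_norm ?invr_ge0// mulVf// normr_eq0.
Qed.

Lemma opnormD T S : opnorm (T + S) <= opnorm T + opnorm S.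
Proof.
apply: opnorm_le => x x1; rewrite (le_trans (ler_normD _ _))// lerD//.
  by apply: (opnorm_supremums T).1; exists x.
by apply: (opnorm_supremums S).1; exists x.
Qed.

Lemma opnormM T S : opnorm (T * S) <= opnorm T * opnorm S.
Proof.
apply: opnorm_le => x x1; rewrite (le_trans (le_opnorm T _))//.
rewrite ler_wpM2l ?opnorm_ge0// (le_trans (le_opnorm S _))//.
by rewrite -[leRHS]mulr1 ler_wpM2l ?opnorm_ge0.
Qed.

Lemma opnormZ a T : opnorm (a *: T) = `|a| * opnorm T.
Proof.
have hle b S : opnorm (b *: S) <= `|b| * opnorm S.
  apply: opnorm_le => x x1; rewrite op_scaleE normrZ ler_wpM2l//.
  by apply: (opnorm_supremums S).1; exists x.
apply/eqP; rewrite eq_le hle /=; have [-> |a0] := eqVneq a 0.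
  by rewrite normr0 mul0r opnorm_ge0.
by rewrite -ler_pdivlMl ?normr_gt0// -normfV -{1}(scalerK a0 T) hle.
Qed.

Lemma opnorm_eq0 T : opnorm T = 0 -> T = 0.
Proof.
move=> T0; apply: bounded_op_ext => x; apply/eqP.
by rewrite -normr_le0 (le_trans (le_opnorm T x))// T0 mul0r.
Qed.

HB.instance Definition _ :=
  Lmodule_isNormed.Build K bounded_op opnormD opnormZ opnorm_eq0.

Lemma op_normE T : `|T| = opnorm T. Proof. by []. Qed.

Lemma op_scalerAl (a : K) T S : a *: (T * S) = (a *: T) * S.
Proof. exact: bounded_op_ext. Qed.
Lemma op_scalerAr (a : K) T S : a *: (T * S) = T * (a *: S).
Proof. by apply: bounded_op_ext => x; rewrite op_mulE op_scaleE linearZ. Qed.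

Lemma op_normrM T S : `|T * S| <= `|T| * `|S|.
Proof. exact: opnormM. Qed.

End BoundedOperators.

Arguments bounded_linear {R k} E.

Section BoundedOperatorsComplete.
Context {R : realType} {k : scalar_kind}.
Local Notation K := (scalars R k).
Variable E : completeNormedModType K.
Implicit Types T S : bounded_op E.

Lemma op_ball T (e : K) S : ball T e S -> forall x, `|T x - S x| <= e * `|x|.
Proof.
rewrite -ball_normE /= op_normE => TS x.
by rewrite -op_subE (le_trans (le_opnorm _ _))// ler_wpM2r// ltW.
Qed.

Lemma bounded_op_cauchy_cvg (F : set_system (bounded_op E)) :
  ProperFilter F -> cauchy F -> cvg F.
Proof.
move=> FF /cauchyP Fc.
have Fx x : cvg (T x @[T --> F]).
  apply: cauchy_cvg; apply: cauchy_exP => e e0.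
  have x1 : 0 < `|x| + 1 by rewrite ltr_wpDl.
  have [T0 FT0] := Fc (e / (`|x| + 1)) (divr_gt0 e0 x1).
  exists (T0 x); suff: F [set T | ball (T0 x) e (T x)] by [].
  apply: filterS FT0 => T /op_ball/(_ x) TT0 /=.
  rewrite -ball_normE /=. apply: (le_lt_trans TT0).
  by rewrite mulrAC ltr_pdivrMr// ltr_pM2l// ltrDl.
pose f x : E := lim (T x @[T --> F]).
have fP T0 (e : K) : F (ball T0 e) -> forall x, `|T0 x - f x| <= e * `|x|.
  move=> FT0 x; apply/ler_addgt0Pr => d d0.
  have Fd : F [set T | `|f x - T x| < d].
    by have /cvgr_dist_lt/(_ _ d0) := Fx x.
  have [T [/op_ball/(_ x) T1 T2]] := filter_ex (filterI FT0 Fd).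
  rewrite (le_trans (ler_distD (T x) _ _))// lerD// ltW//.
  by rewrite distrC.
have fl : linear f.
  move=> a x y; apply/eqP; rewrite -subr_eq0 -normr_le0; apply/ler_addgt0Pr.
  move=> d d0; rewrite add0r.
  pose c : K := `|a *: x + y| + (`|a| * `|x| + `|y|) + 1.
  have c0 : 0 < c by rewrite /c ltr_wpDl// !addr_ge0// mulr_ge0.
  have [T0 /fP T0f] := Fc (d / c) (divr_gt0 d0 c0).
  have -> : f (a *: x + y) - (a *: f x + f y) =
      (f (a *: x + y) - T0 (a *: x + y)) +
      (a *: (T0 x - f x) + (T0 y - f y)).
    rewrite scalerBr [X in _ = _ + X]addrACA -opprD.
    by rewrite -bounded_op_linear addrA subrK.
  have dc : 0 < d / c by exact: divr_gt0.
  apply: (@le_trans _ _ (d / c * (`|a *: x + y| + (`|a| * `|x| + `|y|)))).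
    rewrite (le_trans (ler_normD _ _))// mulrDr lerD//.
      by rewrite distrC T0f.
    rewrite (le_trans (ler_normD _ _))// mulrDr lerD//.
    by rewrite normrZ mulrCA ler_wpM2l.
  rewrite mulrAC ler_pdivrMr// ler_wpM2l ?(ltW d0)//.
  by rewrite lerDl.
have [T0 /fP T0f] := Fc 1 ltr01.
have fb : f \in bounded_linear E.
  apply/asboolP; split => //; exists (`|T0| + 1) => x.
  rewrite -[f x](subKr (T0 x)) (le_trans (ler_normB _ _))// mulrDl lerD//.
  exact: le_opnorm.
apply/cvg_ex; exists (BoundedOp fb); apply/cvgrPdist_le => /= e e0.
have [S FS] := Fc (e / 2) (divr_gt0 e0 (ltr0Sn _ 1)).
apply: filterS (FS) => T ST.
rewrite op_normE; apply: opnorm_le => x x1; rewrite op_subE /=.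
rewrite (le_trans (ler_distD (S x) _ _))//.
rewrite (le_trans (lerD (_ : _ <= e / 2) (_ : _ <= e / 2)))//.
- rewrite distrC (le_trans (fP _ _ FS x))//.
  by rewrite -[leRHS]mulr1 ler_wpM2l// divr_ge0// ltW.
- rewrite (le_trans (op_ball ST x))//.
  by rewrite -[leRHS]mulr1 ler_wpM2l// divr_ge0// ltW.
- by rewrite -splitr.
Qed.

HB.instance Definition _ :=
  Uniform_isComplete.Build (bounded_op E) bounded_op_cauchy_cvg.

End BoundedOperatorsComplete.

Section CompactOperators.
Context {R : realType} {k : scalar_kind}.
Local Notation K := (scalars R k).
Variable E : normedModType K.
Implicit Types T S : bounded_op E.

Local Notation B := [set x : E | `|x| <= 1].

Definition compact_op : {pred bounded_op E} :=
  [pred T : bounded_op E | `[< compact (closure (T @` B)) >]].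

Lemma compact_opP T :
  reflect (exists2 C, compact C & T @` B `<=` C) (T \in compact_op).
Proof.
apply: (iffP (asboolP _)) => [cT|[C cC TC]].
  by exists (closure (T @` B)) => //; exact: subset_closure.
have /compact_closed clC := norm_hausdorff (V := E).
rewrite -precompactE; apply: (precompact_subset TC).
by rewrite (precompact_closed (clC _ cC)).
Qed.

Lemma op_continuous T : continuous T.
Proof.
apply/linear_bounded_continuous/linear_boundedP.
have [M M0 TM] := bounded_op_bounded T; near=> r => x.
rewrite (le_trans (TM x))// ler_wpM2r//; near: r.
by apply: nbhs_pinfty_ge; rewrite ger0_real.
Unshelve. all: by end_near. Qed.

Lemma compact_op_zmod_closed : zmod_closed compact_op.
Proof.
split=> [|T S /compact_opP[C cC TC] /compact_opP[D cD SD]].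
  apply/compact_opP; exists [set 0]; first exact: compact_set1.
  by move=> _ [x _ <-].
apply/compact_opP; exists ((fun z : E * E => z.1 - z.2) @` (C `*` D)).
  apply: continuous_compact; last exact: compact_setX.
  apply: continuous_subspaceT => z; exact: sub_continuous.
move=> _ [x x1 <-]; exists (T x, S x) => //=; split.
  by apply: TC; exists x.
by apply: SD; exists x.
Qed.

HB.instance Definition _ :=
  GRing.isZmodClosed.Build (bounded_op E) compact_op compact_op_zmod_closed.

Lemma compact_op_mull T S : S \in compact_op -> T * S \in compact_op.
Proof.
move=> /compact_opP[C cC SC]; apply/compact_opP; exists (T @` C).
  apply: continuous_compact => //; apply: continuous_subspaceT.
  exact: op_continuous.
by move=> _ [x x1 <-]; exists (S x) => //; apply: SC; exists x.
Qed.

Lemma compact_op_scale (a : K) T : T \in compact_op -> a *: T \in compact_op.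
Proof.
move=> /(compact_op_mull (a *: (1 : bounded_op E))).
by rewrite -op_scalerAl mul1r.
Qed.

Lemma compact_op_mulr T S : T \in compact_op -> T * S \in compact_op.
Proof.
pose c := `|S| + 1; have c0 : 0 < c by rewrite ltr_wpDl.
move=> /(compact_op_scale c)/compact_opP[C cC TC]; apply/compact_opP.
exists C => // _ [x /= x1 <-]; apply: TC; exists (c^-1 *: S x).
  rewrite /= normrZ ger0_norm ?invr_ge0 ?(ltW c0)// ler_pdivrMl// mulr1.
  rewrite (le_trans (le_opnorm S x))// (@le_trans _ _ `|S|) ?lerDl//.
  by rewrite -[leRHS]mulr1 ler_wpM2l ?opnorm_ge0.
by rewrite op_scaleE linearZ scalerA divff ?scale1r// gt_eqF.
Qed.

End CompactOperators.

Arguments compact_op {R k} E.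

Section CompactOperatorsClosed.
Context {R : realType} {k : scalar_kind}.
Local Notation K := (scalars R k).
Variable E : completeNormedModType K.
Implicit Types T S : bounded_op E.

Lemma compact_op_closed T :
  (forall e : K, 0 < e -> exists2 S, S \in compact_op E & `|T - S| < e) ->
  T \in compact_op E.
Proof.
move=> TS; apply/asboolP; rewrite compact_ultra => G GU GC.
set C := closure _ in GC *.
have /cauchy_cvg/cvg_ex[p Gp] : cauchy G.
  apply: cauchy_exP => e e0; have e4 : 0 < e / 2 / 2 by rewrite !divr_gt0.
  have [S /compact_opP[D cD SD] ST] := TS _ e4.
  rewrite compact_cover in cD.
  have [|x Dx|X _ DX] := cD E setT (fun x => ball x (e / 2)).
  - by move=> x _; exact: ball_open.
  - by exists x => //; apply: ballxx; rewrite divr_gt0.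
  apply: contrapT => nG.
  have GX : G (\bigcap_(x in [set` X]) (~` ball x e)).
    apply: filter_bigI => x _.
    by have [Gx|//] := in_ultra_setVsetC (ball x e) GU; case: nG; exists x.
  have [y [Cy Xy]] := filter_ex (filterI GC GX).
  have [_ [[x x1 <-] yTx]] := Cy _ (nbhsx_ballx y _ e4).
  have [z Xz zSx] : cover [set` X] (fun x => ball x (e / 2)) (S x).
    by apply: DX; apply: SD; exists x.
  apply: (Xy z Xz); apply: (ball_split zSx).
  apply: (@ball_splitl _ _ (T x)) => //.
  rewrite -ball_normE /= distrC -op_subE (le_lt_trans (le_opnorm _ _))//.
  rewrite (le_lt_trans _ ST)// -[leRHS]mulr1 ler_wpM2l ?opnorm_ge0//.
exists p; split => //; apply: closed_closure => U pU.
exact: filter_ex (filterI GC (Gp U pU)).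
Qed.

End CompactOperatorsClosed.

Section CalkinAlgebra.
Context {R : realType} {k : scalar_kind}.
Local Notation K := (scalars R k).
Variable E : completeNormedModType K.
Implicit Types (T S : bounded_op E) (a : K).

Definition calkin : Type :=
  {ideal_quot (compact_op E : zmodClosed (bounded_op E))}.

HB.instance Definition _ := Choice.on calkin.
HB.instance Definition _ := GRing.Zmodule.on calkin.
HB.instance Definition _ := Quotient.on calkin.

Local Open Scope quotient_scope.
Implicit Types p q r : calkin.

Lemma calkin_eqP T S :
  reflect (\pi_calkin T = \pi_calkin S) (T - S \in compact_op E).
Proof. by rewrite Quotient.idealrBE; exact: eqP. Qed.

Lemma calkin_piD T S : \pi_calkin (T + S) = \pi_calkin T + \pi_calkin S.
Proof. exact: Quotient.pi_add. Qed.

Lemma calkin_piN T : \pi_calkin (- T) = - \pi_calkin T.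
Proof. exact: Quotient.pi_opp. Qed.

Lemma calkin_pi0 : \pi_calkin 0 = 0.
Proof.
by rewrite -[X in \pi_calkin X](subrr 0) calkin_piD calkin_piN subrr.
Qed.

Definition calkin_one : calkin := \pi_calkin 1.
Definition calkin_mul p q : calkin := \pi_calkin (repr p * repr q).
Definition calkin_scale a p : calkin := \pi_calkin (a *: repr p).

Lemma calkin_repr T : repr (\pi_calkin T) - T \in compact_op E.
Proof. by apply/calkin_eqP; rewrite reprK. Qed.

Lemma calkin_mul_pi T S :
  calkin_mul (\pi_calkin T) (\pi_calkin S) = \pi_calkin (T * S).
Proof.
apply/calkin_eqP.
have -> : repr (\pi_calkin T) * repr (\pi_calkin S) - T * S =
  (repr (\pi_calkin T) - T) * repr (\pi_calkin S) +
  T * (repr (\pi_calkin S) - S) by rewrite mulrBl mulrBr addrA subrK.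
by apply: rpredD; [apply: compact_op_mulr|apply: compact_op_mull];
  exact: calkin_repr.
Qed.

Lemma calkin_scale_pi a T : calkin_scale a (\pi_calkin T) = \pi_calkin (a *: T).
Proof.
by apply/calkin_eqP; rewrite -scalerBr compact_op_scale// calkin_repr.
Qed.

Lemma calkin_mulA : associative calkin_mul.
Proof.
elim/quotW=> T; elim/quotW=> S; elim/quotW=> U.
by rewrite (calkin_mul_pi S U) (calkin_mul_pi T S) !calkin_mul_pi mulrA.
Qed.
Lemma calkin_mul1l : left_id calkin_one calkin_mul.
Proof. by elim/quotW=> T; rewrite calkin_mul_pi mul1r. Qed.
Lemma calkin_mul1r : right_id calkin_one calkin_mul.
Proof. by elim/quotW=> T; rewrite calkin_mul_pi mulr1. Qed.
Lemma calkin_mulDl : left_distributive calkin_mul +%R.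
Proof.
elim/quotW=> T; elim/quotW=> S; elim/quotW=> U.
by rewrite -calkin_piD !calkin_mul_pi mulrDl calkin_piD.
Qed.
Lemma calkin_mulDr : right_distributive calkin_mul +%R.
Proof.
elim/quotW=> T; elim/quotW=> S; elim/quotW=> U.
by rewrite -calkin_piD !calkin_mul_pi mulrDr calkin_piD.
Qed.

HB.instance Definition _ := GRing.Zmodule_isPzRing.Build calkin
  calkin_mulA calkin_mul1l calkin_mul1r calkin_mulDl calkin_mulDr.

Lemma calkin_scalerA a b p :
  calkin_scale a (calkin_scale b p) = calkin_scale (a * b) p.
Proof.
by elim/quotW: p => T; rewrite (calkin_scale_pi b T) !calkin_scale_pi scalerA.
Qed.
Lemma calkin_scale1r : left_id 1 calkin_scale.
Proof. by elim/quotW=> T; rewrite calkin_scale_pi scale1r. Qed.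
Lemma calkin_scalerDr : right_distributive calkin_scale +%R.
Proof.
move=> a; elim/quotW=> T; elim/quotW=> S.
by rewrite -calkin_piD !calkin_scale_pi scalerDr calkin_piD.
Qed.
Lemma calkin_scalerDl p : {morph calkin_scale^~ p : a b / a + b}.
Proof.
by elim/quotW: p => T a b; rewrite !calkin_scale_pi scalerDl calkin_piD.
Qed.

HB.instance Definition _ := GRing.Zmodule_isLmodule.Build K calkin
  calkin_scalerA calkin_scale1r calkin_scalerDr calkin_scalerDl.

Lemma calkin_piM T S : \pi_calkin (T * S) = \pi_calkin T * \pi_calkin S.
Proof. exact/esym/calkin_mul_pi. Qed.

Lemma calkin_piZ a T : \pi_calkin (a *: T) = a *: \pi_calkin T.
Proof. exact/esym/calkin_scale_pi. Qed.

Definition calkin_norm q : K :=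
  infimum 0 [set `|T| | T in [set T | \pi_calkin T = q]].

Lemma calkin_norm_infimums q :
  infimums [set `|T| | T in [set T | \pi_calkin T = q]] (calkin_norm q).
Proof.
have A0 : [set `|T| | T in [set T | \pi_calkin T = q]] !=set0.
  by exists `|repr q|; exists (repr q) => //=; rewrite reprK.
rewrite /calkin_norm /infimum; case: ifPn => [/eqP A00|_].
  by move: A0; rewrite A00 => -[].
by apply: xgetPex; apply: scalars_infimums => // _ [T _ <-] /=.
Qed.

Lemma calkin_norm_le T : calkin_norm (\pi_calkin T) <= `|T|.
Proof. by apply: (calkin_norm_infimums _).1; exists T. Qed.

Lemma le_calkin_norm q (M : K) :
  (forall T, \pi_calkin T = q -> M <= `|T|) -> M <= calkin_norm q.
Proof.
by move=> qM; apply: (calkin_norm_infimums _).2 => _ [T /= Tq <-]; exact: qM.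
Qed.

Lemma calkin_norm_ge0 q : 0 <= calkin_norm q.
Proof. by apply: le_calkin_norm. Qed.

Lemma calkin_norm_approx q (e : K) : 0 < e ->
  exists2 T, \pi_calkin T = q & `|T| < calkin_norm q + e.
Proof.
move=> e0; apply: contrapT => nq.
have : calkin_norm q + e <= calkin_norm q.
  apply: le_calkin_norm => T Tq; rewrite real_leNgt ?ger0_real//.
    by apply/negP => Tlt; apply: nq; exists T.
  by rewrite addr_ge0 ?calkin_norm_ge0// ltW.
by rewrite gerDl => /(lt_le_trans e0); rewrite ltxx.
Qed.

Lemma calkin_normD p q : calkin_norm (p + q) <= calkin_norm p + calkin_norm q.
Proof.
apply/ler_addgt0Pr => e e0; have e2 : 0 < e / 2 by rewrite divr_gt0.
have [T <- Tlt] := calkin_norm_approx p e2.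
have [S <- Slt] := calkin_norm_approx q e2.
rewrite -calkin_piD (le_trans (calkin_norm_le _))//.
rewrite (le_trans (ler_normD _ _))// [e]splitr addrACA.
by rewrite ltW// ltrD.
Qed.

Lemma calkin_normZ a q : calkin_norm (a *: q) = `|a| * calkin_norm q.
Proof.
have hle b p : b != 0 -> calkin_norm (b *: p) <= `|b| * calkin_norm p.
  move=> b0; rewrite -ler_pdivrMl ?normr_gt0//; apply: le_calkin_norm => T <-.
  rewrite ler_pdivrMl ?normr_gt0// -normrZ -calkin_piZ.
  exact: calkin_norm_le.
have [-> |a0] := eqVneq a 0.
  rewrite scale0r normr0 mul0r; apply/eqP; rewrite eq_le calkin_norm_ge0 andbT.
  by rewrite -calkin_pi0 -[leRHS](normr0 (bounded_op E)) calkin_norm_le.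
apply/eqP; rewrite eq_le hle //=.
by rewrite -ler_pdivlMl ?normr_gt0// -normfV -{1}(scalerK a0 q) hle ?invr_eq0.
Qed.

Lemma calkin_norm_eq0 q : calkin_norm q = 0 -> q = 0.
Proof.
move=> q0; rewrite -[q]reprK -calkin_pi0; apply/calkin_eqP; rewrite subr0.
apply: compact_op_closed => e /(calkin_norm_approx q)[T Tq].
rewrite q0 add0r => Te; exists (repr q - T); last first.
  by rewrite opprB addrC subrK.
by apply/calkin_eqP; rewrite reprK.
Qed.

HB.instance Definition _ :=
  Lmodule_isNormed.Build K calkin calkin_normD calkin_normZ calkin_norm_eq0.

Lemma calkin_normE q : `|q| = calkin_norm q. Proof. by []. Qed.

Lemma calkin_scalerAl a p q : a *: (p * q) = (a *: p) * q.
Proof.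
elim/quotW: p => T; elim/quotW: q => S.
by rewrite -calkin_piM -!calkin_piZ -calkin_piM op_scalerAl.
Qed.

Lemma calkin_scalerAr a p q : a *: (p * q) = p * (a *: q).
Proof.
elim/quotW: p => T; elim/quotW: q => S.
by rewrite -calkin_piM -!calkin_piZ -calkin_piM op_scalerAr.
Qed.

Lemma calkin_normrM p q : `|p * q| <= `|p| * `|q|.
Proof.
have hle T r : `|\pi_calkin T * r| <= `|T| * `|r|.
  have [T0|T0] := eqVneq `|T| 0.
    have -> : T = 0 by apply/eqP; rewrite -normr_eq0 T0.
    by rewrite calkin_pi0 mul0r !normr0 mul0r.
  have {}T0 : 0 < `|T| by rewrite lt_neqAle eq_sym T0 normr_ge0.
  rewrite -ler_pdivrMl//; apply: le_calkin_norm => S <-.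
  rewrite ler_pdivrMl// -calkin_piM (le_trans (calkin_norm_le _))//.
  exact: op_normrM.
have [q0|q0] := eqVneq `|q| 0.
  have -> : q = 0 by apply/eqP; rewrite -normr_eq0 q0.
  by rewrite mulr0 !normr0 mulr0.
have {}q0 : 0 < `|q| by rewrite lt_neqAle eq_sym q0 normr_ge0.
rewrite -ler_pdivrMr//; apply: le_calkin_norm => T <-.
by rewrite ler_pdivrMr.
Qed.

Lemma calkin_cauchy_cvg (F : set_system calkin) :
  ProperFilter F -> cauchy F -> cvg F.
Proof.
move=> FF /cauchyP Fc.
pose h : K := 2^-1; have h0 n : 0 < h ^+ n by rewrite exprn_gt0 ?invr_gt0.
have hS n : h ^+ n = h ^+ n.+1 + h ^+ n.+1.
  by rewrite exprSr; exact: splitr.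
have /choice[q Fq] : forall n, exists p, F (ball p (h ^+ n)).
  by move=> n; exact: Fc.
have qS n : `|q n.+1 - q n| < h ^+ n *+ 2.
  have [p []] := filter_ex (filterI (Fq n) (Fq n.+1)).
  rewrite -!ball_normE /= => pn pn1; rewrite mulr2n.
  rewrite (le_lt_trans (ler_distD p _ _))// ltrD// 1?distrC//.
  by rewrite distrC (lt_trans pn1)// [ltRHS]hS ltrDl.
have /choice[U Uq] : forall n, exists U : bounded_op E,
    \pi_calkin U = q n.+1 - q n /\ `|U| < h ^+ n *+ 2.
  move=> n; have [|U Uq Ul] := @calkin_norm_approx (q n.+1 - q n)
    (h ^+ n *+ 2 - `|q n.+1 - q n|); first by rewrite subr_gt0.
  by exists U; split => //; move: Ul; rewrite addrC subrK.
pose T n := repr (q 0%N) + \sum_(i < n) U i.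
have Tq n : \pi_calkin (T n) = q n.
  elim: n => [|n IHn]; first by rewrite /T big_ord0 addr0 reprK.
  rewrite /T big_ord_recr addrA calkin_piD IHn (Uq n).1.
  by rewrite addrC subrK.
have TT n j : `|T (n + j)%N - T n| <= h ^+ n *+ 4 - h ^+ (n + j) *+ 4.
  elim: j => [|j IHj]; first by rewrite addn0 !subrr normr0.
  have -> : T (n + j.+1)%N - T n = (T (n + j)%N - T n) + U (n + j)%N.
    by rewrite addnS /T big_ord_recr /= addrA [RHS]addrAC.
  rewrite (le_trans (ler_normD _ _))// (le_trans (lerD IHj (ltW (Uq _).2)))//.
  rewrite addnS -addrA lerD2l [h ^+ (n + j)]hS -mulr2n -!mulrnA.
  by rewrite -[(2 * 4)%N]/(4 + 4)%N mulrnDr opprD subrK.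
have TT4 n m : (n <= m)%N -> `|T m - T n| <= h ^+ n *+ 4.
  move=> /subnKC <-; rewrite (le_trans (TT _ _))// gerBl mulrn_wge0// ltW//.
have small (e : K) : 0 < e -> exists n, h ^+ n *+ 4 < e.
  move=> e0; have [|n ne] := @scalars_archi R k (e / 4).
    by rewrite divr_gt0.
  by exists n; rewrite -mulr_natr -ltr_pdivlMr.
have /cvg_ex[L TL] : cvg (T n @[n --> \oo]).
  apply: cauchy_cvg; apply: cauchy_exP => e /small[n ne].
  exists (T n); exists n => // m nm; rewrite -ball_normE /= distrC.
  exact: le_lt_trans (TT4 _ _ nm) ne.
have TnL n : `|L - T n| <= h ^+ n *+ 4.
  apply/ler_addgt0Pr => d d0.
  have [N _ NL] : \forall m \near \oo, `|L - T m| < d by exact: cvgr_dist_lt.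
  pose m := maxn n N; rewrite (le_trans (ler_distD (T m) _ _))// addrC lerD//.
    by rewrite TT4// leq_maxl.
  by rewrite ltW//; apply: NL; exact: leq_maxr.
apply/cvg_ex; exists (\pi_calkin L); apply/cvgrPdist_lt => /= e e0.
have [|n ne] := small (e / 2); first by rewrite divr_gt0.
apply: filterS (Fq n) => p; rewrite -ball_normE /= => qp.
rewrite (le_lt_trans (ler_distD (q n) _ _))// [e]splitr ltrD//.
  rewrite (le_lt_trans _ ne)// (le_trans _ (TnL n))//.
  by rewrite -{1}(Tq n) -calkin_piN -calkin_piD calkin_norm_le.
rewrite (lt_le_trans qp)// (le_trans _ (ltW ne))//.
by rewrite mulrS lerDl mulrn_wge0// ltW.
Qed.

HB.instance Definition _ :=
  Uniform_isComplete.Build calkin calkin_cauchy_cvg.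

End CalkinAlgebra.

Section Subspaces.
Context {R : realType} {k : scalar_kind}.
Local Notation K := (scalars R k).
Variable E : normedModType K.
Implicit Type F : set E.

Definition linear_subspace F :=
  F 0 /\ forall (a : K) x y, F x -> F y -> F (a *: x + y).

Definition complemented F :=
  exists2 P : bounded_op E, P * P = P & range P = F.

(* f is the isomorphism of E onto F; its inverse on F is the restriction of g,
   which is automatically linear. *)
Definition isomorphic_to_ambient F := exists f g : E -> E,
  [/\ linear f, continuous f, range f = F, cancel f g
    & {within F, continuous g}].

(* dim (E / F) is infinite: no finite family spans E modulo F. *)
Definition infinite_codimension F :=
  ~ exists (n : nat) (v : 'I_n -> E),
      forall x, exists a : 'I_n -> K, F (x - \sum_(i < n) a i *: v i).

End Subspaces.

(* Main.v *)
Require Import Defs.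
From HB Require Import structures.
From mathcomp Require Import all_boot all_order all_algebra finmap.
From mathcomp Require Import all_classical all_reals.
From mathcomp Require Import topology normedtype.

Import Order.TTheory GRing.Theory Num.Theory.
Import numFieldNormedType.Exports.

Local Open Scope classical_set_scope.
Local Open Scope ring_scope.

(** Banach's fixed point theorem with ratio 1/2, by iteration from 0. It takes the place of a
    Neumann series when an element near the unit has to be inverted. *)
Lemma half_contraction_fixpoint (R : realType) (k : scalar_kind)
    (A : completeNormedModType (scalars R k)) (f : A -> A) :
  (forall x y, `|f x - f y| <= 2^-1 * `|x - y|) -> exists x, f x = x.
Proof.
move=> fh; pose h : scalars R k := 2^-1; pose u n := iter n f 0.
have h0 n : 0 < h ^+ n by rewrite exprn_gt0 ?invr_gt0.
(* The bound is the sum of the geometric series with first term the norm of [f 0] and ratio 1/2. *)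
have u0 j : `|u j - u 0%N| <= `|f 0| *+ 2.
  elim: j => [|j IHj]; first by rewrite subrr normr0 mulrn_wge0.
  rewrite (le_trans (ler_distD (f 0) _ _))// mulr2n lerD ?subr0//.
  rewrite (le_trans (fh _ _))// ler_pdivrMl// mulr_natl.
  exact: IHj.
have uB n j : `|u (n + j)%N - u n| <= h ^+ n * (`|f 0| *+ 2).
  elim: n => [|n IHn]; first by rewrite expr0 mul1r u0.
  by rewrite (le_trans (fh _ _))// exprS -mulrA ler_wpM2l// invr_ge0.
have usmall (e : scalars R k) : 0 < e ->
    exists n, forall m, (n <= m)%N -> `|u m - u n| < e.
  move=> e0; have c0 : 0 < `|f 0| *+ 2 + 1 by rewrite ltr_wpDl ?mulrn_wge0.
  have [n nE] := scalars_archi (divr_gt0 e0 c0).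
  exists n => m /subnKC <-; rewrite (le_lt_trans (uB _ _))//.
  rewrite (@le_lt_trans _ _ (h ^+ n * (`|f 0| *+ 2 + 1))) -?ltr_pdivlMr//.
  by rewrite ler_wpM2l ?lerDl// ltW.
have /cvg_ex[L uL] : cvg (u n @[n --> \oo]).
  apply: cauchy_cvg; apply: cauchy_exP => e /usmall[n ne].
  exists (u n); exists n => // m nm; rewrite -ball_normE /= distrC.
  exact: ne.
exists L; apply/eqP; rewrite -subr_eq0 -normr_le0; apply/ler_addgt0Pr => e e0.
rewrite add0r.
have e2 : 0 < e / 2 by rewrite divr_gt0.
have [N _ NL] : \forall m \near \oo, `|L - u m| < e / 2 by exact: cvgr_dist_lt.
rewrite (le_trans (ler_distD (u N.+1) _ _))// [e]splitr lerD//.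
  rewrite (le_trans (fh _ _))// (@le_trans _ _ `|L - u N|)//.
    by rewrite ler_piMl// invf_le1// ler1n.
  by rewrite ltW// NL /=.
by rewrite distrC ltW// NL /=.
Qed.

(* If [(a, b)] is close to [(j, s)], then [b * j] is close to [1], so [b] has a
   right inverse in [j * A]; were [a * b] left invertible, that right inverse
   would be two-sided and [j] would be invertible. But the idempotent
   [p = j * s] is the limit of the invertible elements [p + t *: (1 - p)]. *)
Lemma not_open_multiplication (R : realType) (k : scalar_kind)
    (A : completeNormedModType (scalars R k)) (mul : A -> A -> A) (one : A)
    (mulA : associative mul) (mul1 : left_id one mul) (mulr1 : right_id one mul)
    (mulDl : left_distributive mul +%R) (mulDr : right_distributive mul +%R)
    (scaleAl : forall a x y, a *: mul x y = mul (a *: x) y)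
    (scaleAr : forall a x y, a *: mul x y = mul x (a *: y))
    (normM : forall x y, `|mul x y| <= `|x| * `|y|) (s j : A) :
  mul s j = one -> mul j s <> one -> ~ open_multiplication mul.
Proof.
move=> sj js mulo.
have mulNr x y : mul x (- y) = - mul x y by rewrite -scaleN1r -scaleAr scaleN1r.
have mulNl x y : mul (- x) y = - mul x y by rewrite -scaleN1r -scaleAl scaleN1r.
have j1 : 0 < `|j| + 1 by rewrite ltr_wpDl.
(* For [b] within [r] of [s], the product [(s - b) j] has norm at most 1/2. *)
pose r := (2 * (`|j| + 1))^-1.
have r0 : 0 < r by rewrite invr_gt0 mulr_gt0.
pose p := mul j s; pose q := one - p.
have pp : mul p p = p by rewrite /p -mulA (mulA s) sj mul1.
have pq : mul p q = 0 by rewrite /q mulDr mulNr mulr1 pp subrr.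
have qp : mul q p = 0 by rewrite /q mulDl mulNl mul1 pp subrr.
have qq : mul q q = q by rewrite {2}/q mulDr mulNr qp subr0 mulr1.
(* Only the second factor is confined: [b] must be near [s], while [a] enters only through the
   product [a b]. *)
have /mulo oV : open [set x : A * A | ball s r x.2].
  by apply: (open_comp _ (ball_open s r)) => x _; exact: cvg_snd.
have /nbhs_ballP[e /= e0 pe] : nbhs p
    [set mul x.1 x.2 | x in [set x : A * A | ball s r x.2]].
  by apply: open_nbhs_nbhs; split => //; exists (j, s) => //=; exact: ballxx.
have q1 : 0 < `|q| + 1 by rewrite ltr_wpDl.
(* Small enough that [p + t *: q] lies within [e] of [p], and nonzero so that this element is
   invertible. *)
pose t := e / 2 / (`|q| + 1).
have t0 : 0 < t by rewrite !divr_gt0.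
have [|[a b] /= sb ab] := pe (p + t *: q).
  rewrite -ball_normE /= opprD addrA subrr sub0r normrN normrZ gtr0_norm//.
  rewrite /t mulrAC ltr_pdivrMr// (@lt_le_trans _ _ (e / 2 * (`|q| + 1)))//.
    by rewrite ltr_pM2l ?divr_gt0// ltrDl.
  by rewrite ler_pM2r// ler_pdivrMr// ler_peMr ?ler1n// ltW.
(* A right inverse of [b j] is a fixed point of [y |-> 1 + (1 - b j) y], a contraction because
   [1 - b j = (s - b) j]. *)
have [y by1] : exists y, mul (mul b j) y = one.
  have [|y yE] := @half_contraction_fixpoint R k A
    (fun y => one + mul (one - mul b j) y).
    move=> y z; rewrite opprD addrACA subrr add0r -(mulNr (one - _)) -mulDr.
    rewrite (le_trans (normM _ _))// ler_wpM2r//.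
    rewrite -sj -(mulNl b) -mulDl (le_trans (normM _ _))//.
    rewrite (@le_trans _ _ (r * (`|j| + 1)))//; last first.
      by rewrite /r invfM -mulrA mulVf ?mulr1 ?gt_eqF// GRing.mulr1.
    rewrite ler_pM ?lerDl//.
    by move: sb; rewrite -ball_normE /= => /ltW.
  exists y; move: yE; rewrite mulDl mulNl mul1 => /eqP.
  by rewrite addrCA -subr_eq0 addrAC subrr add0r subr_eq0 eq_sym => /eqP ->.
(* [p] and [q] are orthogonal idempotents with sum 1, so the first factor inverts
   [p + t *: q = a b]. *)
pose l := mul (p + t^-1 *: q) a.
have lb : mul l b = one.
  rewrite /l -mulA ab mulDl !mulDr -!scaleAl -!scaleAr pp pq qp qq.
  rewrite !scaler0 addr0 add0r scalerA mulVf ?gt_eqF// scale1r.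
  by rewrite /q addrC subrK.
(* The left inverse [l] and the right inverse [j y] of [b] coincide, so [y b] is a right inverse of
   [j]. *)
have lE : l = mul j y by rewrite -[l]mulr1 -by1 -(mulA b) (mulA l) lb mul1.
have jyb : mul j (mul y b) = one by rewrite mulA -lE.
by apply: js; rewrite -[s]mulr1 -jyb (mulA s) sj mul1.
Qed.

(* Each point of the unit ball of [range Q] lies within 1/2 of one of finitely
   many points [c i] of [range Q]; iterating on twice the remainder writes it
   as a dyadic series in the [c i], whose coefficients converge. *)
Lemma compact_idempotent_finite_range (R : realType) (k : scalar_kind)
    (E : normedModType (scalars R k)) (Q : bounded_op E) :
  Q * Q = Q -> Q \in compact_op E -> exists (n : nat) (c : 'I_n -> E),
    forall x, exists a : 'I_n -> scalars R k, Q x = \sum_(i < n) a i *: c i.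
Proof.
move=> QQ /asboolP cQ; pose B := [set x : E | `|x| <= 1].
have QE x : Q (Q x) = Q x by rewrite -op_mulE QQ.
have [n [c [Qc cB]]] : exists (n : nat) (c : 'I_n -> E),
    (forall i, Q (c i) = c i) /\
    forall z, Q z = z -> `|z| <= 1 -> exists i, `|z - c i| <= 2^-1.
  rewrite compact_cover in cQ.
  (* Balls centred in the image of the unit ball already cover its closure, and such centres are
     fixed by [Q]. *)
  have [|x|D DQ QD] := cQ E (Q @` B) (fun x => ball x 2^-1).
  - by move=> x _; exact: ball_open.
  - move=> /(_ _ (nbhsx_ballx x 2^-1 _))[|y [Qy xy]]; first by rewrite invr_gt0.
    by exists y => //; apply: ball_sym.
  pose s := enum_fset D; exists (size s), (fun i => nth 0 s i); split.
    move=> i; have : nth 0 s i \in D by exact: mem_nth.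
    by move=> /DQ; rewrite inE => -[x _ <-].
  move=> z Qz z1; have [|x /= xD zx] := QD z.
    by apply: subset_closure; exists z.
  have xs : (index x s < size s)%N by rewrite index_mem.
  exists (Ordinal xs); rewrite /= nth_index// distrC.
  by move: zx; rewrite -ball_normE /= => /ltW.
pose N z := Q z = z /\ `|z| <= 1.
have [ix step] : exists ix : E -> 'I_n,
    forall z, N z -> N (2 *: (z - c (ix z))).
  (* Approximating 0 yields an index, the default value of [ix] outside [N]. *)
  have [i _] : exists i, `|0 - c i| <= 2^-1.
    by apply: cB; rewrite ?linear0 ?normr0.
  have /choice[ix ixP] : forall z, exists i, N z -> `|z - c i| <= 2^-1.
    move=> z; have [[Qz z1]|nz] := pselect (N z); last by exists i.
    by have [i' ?] := cB z Qz z1; exists i'.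
  exists ix => z Nz; split; last first.
    by rewrite normrZ ger0_norm// mulrC -ler_pdivlMr// mul1r ixP.
  by rewrite linearZ linearB /= Qc Nz.1.
pose h : scalars R k := 2^-1.
have h0 m : 0 < h ^+ m by rewrite exprn_gt0 ?invr_gt0.
have hS m : h ^+ m = h ^+ m.+1 + h ^+ m.+1 by rewrite exprSr; exact: splitr.
have span1 z : N z -> exists a : 'I_n -> scalars R k,
    z = \sum_(i < n) a i *: c i.
  move=> Nz; pose u m := iter m (fun z => 2 *: (z - c (ix z))) z.
  have Nu m : N (u m) by elim: m => // m; exact: step.
  (* The coefficient of [c i] gathers [h ^+ l] from each step [l < m] that chose [c i]. *)
  pose al m i := \sum_(l < m) (if ix (u l) == i then h ^+ l else 0).
  have alS m i : al m.+1 i = al m i + (if ix (u m) == i then h ^+ m else 0).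
    by rewrite /al big_ord_recr.
  have uE m : z - \sum_(i < n) al m i *: c i = h ^+ m *: u m.
    elim: m => [|m IHm].
      rewrite big1 ?subr0 ?expr0 ?scale1r// => i _.
      by rewrite /al big_ord0 scale0r.
    rewrite /= scalerA exprSr -mulrA mulVf ?pnatr_eq0// mulr1 scalerBr -IHm.
    under eq_bigr do rewrite alS scalerDl.
    rewrite big_split /= opprD addrA; congr (_ - _).
    rewrite (bigD1 (ix (u m)))//= eqxx big1 ?addr0// => i /negPf im.
    by rewrite eq_sym im scale0r.
  (* The increase is at most the finite geometric sum from [m] to [m + d]; keeping its last term
     lets the induction close. *)
  have al_bnd m d i :
      al m i <= al (m + d)%N i <= al m i + h ^+ m *+ 2 - h ^+ (m + d) *+ 2.
    elim: d => [|d /andP[IH1 IH2]]; first by rewrite addn0 addrK lexx.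
    rewrite addnS alS; apply/andP; split.
      by rewrite (le_trans IH1)// lerDl; case: ifP => _ //; exact/ltW/h0.
    rewrite (le_trans (lerD IH2 (_ : _ <= h ^+ (m + d))))//.
      by case: ifP => _; rewrite ?lexx// ltW.
    by rewrite -addrA lerD2l [h ^+ (m + d)]hS -mulr2n mulr2n opprD subrK.
  (* The partial coefficients increase, so their limit is a supremum; it exists for complex scalars
     too, as they are nonnegative. *)
  have sup_al i : exists s, forall m, al m i <= s <= al m i + h ^+ m *+ 2.
    have ub m : ubound (range (al ^~ i)) (al m i + h ^+ m *+ 2).
      move=> _ [m' _ <-]; have [mm'|/ltnW m'm] := leqP m m'.
        rewrite -(subnKC mm'); have /andP[_ /le_trans] := al_bnd m (m' - m)%N i.
        by apply; rewrite gerBl mulrn_wge0// ltW.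
      rewrite -(subnKC m'm); have /andP[+ _] := al_bnd m' (m - m')%N i.
      by move=> /le_trans; apply; rewrite lerDl mulrn_wge0// ltW.
    have [|_ [m _ <-]||s [us ls]] := @scalars_supremums R k (range (al ^~ i)).
    - by exists (al 0%N i), 0%N.
    - by rewrite /= sumr_ge0// => l _; case: ifP => _ //; exact/ltW/h0.
    - by exists (al 0%N i + h ^+ 0 *+ 2); exact: ub.
    exists s => m; apply/andP; split; first by apply: us; exists m.
    by apply: ls; exact: ub.
  have /choice[a aP] := sup_al; exists a.
  apply/eqP; rewrite -subr_eq0 -normr_le0; apply/ler_addgt0Pr => e e0.
  (* In units of [h ^+ m]: 1 for the remainder, and 2 for the error of each coefficient. *)
  pose C : scalars R k := 1 + \sum_(i < n) 2 * `|c i|.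
  have C0 : 0 < C by rewrite ltr_pwDl// sumr_ge0// => i _; rewrite mulr_ge0.
  have [m me] := scalars_archi (divr_gt0 e0 C0).
  rewrite add0r (@le_trans _ _ (h ^+ m * C))//; last first.
    by rewrite -ler_pdivlMr// ltW.
  rewrite (le_trans (ler_distD (\sum_(i < n) al m i *: c i) _ _))//.
  rewrite /C mulrDr lerD//.
    by rewrite uE normrZ gtr0_norm// ler_wpM2l ?(Nu _).2// ltW.
  rewrite -sumrB mulr_sumr (le_trans (ler_norm_sum _ _ _))// ler_sum// => i _.
  rewrite -scalerBl normrZ mulrA ler_wpM2r// mulr_natr.
  have /andP[a1 a2] := aP i m.
  by rewrite distrC ger0_norm ?subr_ge0// lerBlDl.
exists n, c => x; have [Qx0|Qx0] := eqVneq (Q x) 0.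
  by exists (fun=> 0); rewrite Qx0 big1// => i _; rewrite scale0r.
have [|a aE] := span1 (`|Q x|^-1 *: Q x).
  split; first by rewrite linearZ /= QE.
  by rewrite normrZ ger0_norm ?invr_ge0// mulVf// normr_eq0.
exists (fun i => `|Q x| * a i); under eq_bigr do rewrite -scalerA.
by rewrite -scaler_sumr -aE scalerA divff ?scale1r// normr_eq0.
Qed.

Lemma continuous_linear_bounded_linear (R : realType) (k : scalar_kind)
    (E : normedModType (scalars R k)) (f : E -> E) :
  linear f -> continuous f -> f \in bounded_linear E.
Proof.
move=> lf cf; apply/asboolP; split => //.
pose F : {linear E -> E} := HB.pack f (GRing.isLinear.Build _ _ _ _ f lf).
have /linear_bounded_continuous/linear_boundedP : continuous F by exact: cf.
by move=> /pinfty_ex_gt0[M _ fM]; exists M.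
Qed.

(** [j] is the isomorphism onto [F], and [s] is the projection [p] followed by its inverse;
    [s * j = 1] because [p] fixes [F] pointwise. *)
Lemma complemented_copy (R : realType) (k : scalar_kind)
    (E : normedModType (scalars R k)) (F : set E) :
  isomorphic_to_ambient F -> complemented F ->
  exists s j p : bounded_op E,
    [/\ s * j = 1, j * s = p, p * p = p & range p = F].
Proof.
move=> [f [g [lf cf fF gK cg]]] [p pp pF].
have pFx x : F (p x) by rewrite -pF; exists x.
have fgp x : f (g (p x)) = p x.
  by have := pFx x; rewrite -fF => -[y _ <-]; rewrite gK.
(* Linearity is tested after applying the injective map [f], which turns [g \o p] into [p]. *)
have lgp : linear (g \o p).
  move=> a x y /=; apply: (can_inj gK).
  by rewrite lf !fgp linearP.
have cgp : continuous (g \o p).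
  move=> x; move/subspace_continuousP : cg => /(_ (p x) (pFx x)).
  apply: cvg_comp => U; rewrite /within /= nbhs_simpl /= => FU.
  have := op_continuous (T := p) FU.
  by rewrite !nbhs_simpl /=; apply: filterS => y /=; exact.
pose j := BoundedOp (continuous_linear_bounded_linear _ _ _ _ lf cf).
pose s := BoundedOp (continuous_linear_bounded_linear _ _ _ _ lgp cgp).
exists s, j, p; split => //; apply: bounded_op_ext => x.
- have : F (f x) by rewrite -fF; exists x.
  rewrite op_mulE /= -pF => -[y _ yE].
  by rewrite -yE -op_mulE pp yE gK.
- exact: fgp.
Qed.

Theorem theorem4p15 (R : realType) (k : scalar_kind)
    (E : completeNormedModType (scalars R k)) :
  (exists F : set E,
    [/\ linear_subspace F, F <> [set: E], isomorphic_to_ambient F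
      & complemented F]) ->
  ~ @open_multiplication (bounded_op E) *%R /\
  ((exists F : set E,
     [/\ linear_subspace F, F <> [set: E], isomorphic_to_ambient F,
         complemented F & infinite_codimension F]) ->
   ~ @open_multiplication (calkin E) *%R).
Proof.
move=> [F [_ FT isoF compF]]; split.
  have [s [j [p [sj js _ pF]]]] := complemented_copy _ _ _ _ isoF compF.
  apply: (@not_open_multiplication R k (bounded_op E) *%R 1
    _ _ _ _ _ _ _ _ s j) => //.
  - exact: mulrA.
  - exact: mul1r.
  - exact: mulr1.
  - exact: mulrDl.
  - exact: mulrDr.
  - exact: op_scalerAl.
  - exact: op_scalerAr.
  - exact: op_normrM.
  - rewrite js => p1; apply: FT; rewrite -pF p1.
    by apply/seteqP; split => // x _; exists x.
move=> [G [_ _ isoG compG codimG]].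
have [s [j [p [sj js pp pG]]]] := complemented_copy _ _ _ _ isoG compG.
apply: (@not_open_multiplication R k (calkin E) *%R 1 _ _ _ _ _ _ _ _
  (\pi_(calkin E)%qT s) (\pi_(calkin E)%qT j)).
- exact: mulrA.
- exact: mul1r.
- exact: mulr1.
- exact: mulrDl.
- exact: mulrDr.
- exact: calkin_scalerAl.
- exact: calkin_scalerAr.
- exact: calkin_normrM.
- by rewrite -calkin_piM sj.
(* If [p] equals 1 modulo compact operators, then [1 - p] is a compact idempotent, hence of finite
   rank. *)
rewrite -calkin_piM js => /esym/calkin_eqP cq.
have qq : (1 - p) * (1 - p) = 1 - p.
  by rewrite mulrBr mulr1 mulrBl mul1r pp subrr subr0.
have [n [c cE]] := compact_idempotent_finite_range _ _ _ _ qq cq.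
(* As [x - (1 - p) x = p x] lies in [G], the vectors [c i] span [E] modulo [G]. *)
apply: codimG; exists n, c => x; have [a aE] := cE x; exists a.
rewrite -aE op_subE op_oneE opprB addrC subrK -pG.
by exists x.
Qed.
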